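(* Let $(X,\mathcal{A},\mu)$ be a measure space with $\mu(X)=\infty$ and let $I$ be an ideal (not necessarily proper) in $\mathcal{M}(X,\mathcal{A})$. The connected component of $0$ in $\mathcal{M}(X,\mathcal{A})$ equipped with the $m^I_{\mu,F}$-topology is $I\cap L_{\psi,F}(X,\mathcal{A},\mu)$.
   Context: $X$ is a non-empty set, $\mathcal{A}$ a $\sigma$-algebra on $X$, $\mu:\mathcal{A}\to[0,\infty]$ a measure. $\mathcal{M}(X,\mathcal{A})$ is the commutative ring of all measurable functions $X\to\mathbb{R}$ under pointwise operations. A $\mu$-finite set is a set $E\in\mathcal{A}$ with $\mu(E)<\infty$. A positive unit of $\mathcal{M}(X,\mathcal{A})$ is a $u\in\mathcal{M}(X,\mathcal{A})$ with $u(x)>0$ for all $x\in X$. For an ideal $I$, $f\in\mathcal{M}(X,\mathcal{A})$ and a positive unit $u$, put $m_{\mu,F}(f,I,u)=\{g\in\mathcal{M}(X,\mathcal{A}): f-g\in I$ and there is a $\mu$-finite set $E$ with $|f(x)-g(x)|<u(x)$ for all $x\in X\setminus E\}$. These sets form an open base of the $m^I_{\mu,F}$-topology on $\mathcal{M}(X,\mathcal{A})$. $L^\infty_F(X,\mathcal{A},\mu)$ is the set of all $f\in\mathcal{M}(X,\mathcal{A})$ for which there is a $\mu$-finite set $E$ such that $f$ is bounded on $X\setminus E$. $L_{\psi,F}(X,\mathcal{A},\mu)=\{f\in\mathcal{M}(X,\mathcal{A}): f\cdot g\in L^\infty_F(X,\mathcal{A},\mu)$ for all $g\in\mathcal{M}(X,\mathcal{A})\}$.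 *)

(* Defs.v *)
From HB Require Import structures.
From mathcomp Require Import all_boot all_order all_algebra.
From mathcomp Require Import all_classical all_reals all_analysis.
From mathcomp Require Import measurable_realfun.

Set Implicit Arguments.
Unset Strict Implicit.
Unset Printing Implicit Defensive.

Import Order.TTheory GRing.Theory Num.Theory.
Import numFieldNormedType.Exports.

Local Open Scope classical_set_scope.
Local Open Scope ring_scope.

(* MathComp's [idealr] bundles properness; here [1] may belong to the ideal. *)
Record ring_ideal (A : comNzRingType) := RingIdeal {
  ideal_set : set A;
  ideal_has0 : ideal_set 0;
  ideal_hasD : forall a b, ideal_set a -> ideal_set b -> ideal_set (a + b);
  ideal_hasM : forall c a, ideal_set a -> ideal_set (c * a)
}.

Section definitions.
Context (R : realType) (d : measure_display) (T : measurableType d).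
Implicit Types (f g u : {mfun T >-> R}) (mu : {measure set T -> \bar R}).

Definition finite_measure_set mu (E : set T) : Prop :=
  measurable E /\ (mu E < +oo)%E.

Definition positive_unit u : Prop := forall x, 0 < u x.

Definition m_muF mu (I : ring_ideal {mfun T >-> R}) f u : set {mfun T >-> R} :=
  [set g | ideal_set I (f - g) /\
     exists2 E, finite_measure_set mu E &
       forall x, ~ E x -> `|f x - g x| < u x].

Definition Linfty_F mu : set {mfun T >-> R} :=
  [set f | exists2 E, finite_measure_set mu E &
     exists M : R, forall x, ~ E x -> `|f x| <= M].

Definition Lpsi_F mu : set {mfun T >-> R} :=
  [set f | forall g, Linfty_F mu (f * g)].

Definition m_muF_base mu (I : ring_ideal {mfun T >-> R}) :
    set (set {mfun T >-> R}) :=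
  [set B | exists f u, positive_unit u /\ B = m_muF mu I f u].

Lemma m_muF_refl mu (I : ring_ideal {mfun T >-> R}) f u :
  positive_unit u -> m_muF mu I f u f.
Proof.
move=> u0; split; first by rewrite subrr; exact: ideal_has0.
exists set0; last by move=> x _; rewrite subrr normr0.
by split; [exact: measurable0 | rewrite measure0 ltry].
Qed.

Lemma finite_measure_setU mu (E F : set T) :
  finite_measure_set mu E -> finite_measure_set mu F ->
  finite_measure_set mu (E `|` F).
Proof.
move=> [mE fE] [mF fF]; split; first exact: measurableU.
by rewrite (le_lt_trans (measureU2 _ _ _))// lte_add_pinfty.
Qed.

(* Every basic set contains a basic set centred at each of its points. *)
Lemma m_muF_recenter mu (I : ring_ideal {mfun T >-> R}) f u h :
  positive_unit u -> m_muF mu I f u h ->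
  exists2 v, positive_unit v & m_muF mu I h v `<=` m_muF mu I f u.
Proof.
move=> u0 [Ifh [E fE Efh]].
pose w : T -> R := fun x => u x - `|f x - h x|.
have mw : measurable_fun [set: T] w.
  apply: measurable_funB => //.
  apply: measurableT_comp; first exact: normr_measurable.
  exact: measurable_funB.
pose v : T -> R := fun x => if 0 < w x then w x else 1.
have mv : measurable_fun [set: T] v.
  apply: measurable_fun_ifT => //.
  exact: measurable_fun_ltr.
pose V : {mfun T >-> R} := HB.pack v (isMeasurableFun.Build _ _ _ _ v mv).
exists V; first by move=> x; rewrite /= /v; case: ifPn.
move=> g [Ihg [F fF Fhg]]; split.
  have -> : f - g = (f - h) + (h - g) by rewrite addrA subrK.
  exact: ideal_hasD.
exists (E `|` F); first exact: finite_measure_setU.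
move=> x /not_orP[nEx nFx].
have := Fhg x nFx; rewrite /= /v /w subr_gt0 (Efh x nEx) ltrBrDl.
apply: le_lt_trans.
have -> : f x - g x = (f x - h x) + (h x - g x) by rewrite addrA subrK.
exact: ler_normD.
Qed.

Lemma m_muF_base_cover mu (I : ring_ideal {mfun T >-> R}) :
  \bigcup_(B in m_muF_base mu I) B = [set: {mfun T >-> R}].
Proof.
apply/seteqP; split => // f _.
have p1 : positive_unit (1 : {mfun T >-> R}) by move=> x /=; exact: ltr01.
exists (m_muF mu I f 1); last exact: m_muF_refl.
by exists f, 1.
Qed.

Lemma m_muF_base_join mu (I : ring_ideal {mfun T >-> R})
    (A B : set {mfun T >-> R}) h :
  m_muF_base mu I A -> m_muF_base mu I B -> A h -> B h ->
  exists C, [/\ m_muF_base mu I C, C h & C `<=` A `&` B].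
Proof.
move=> [f [u [u0 ->]]] [g [v [v0 ->]]] fuh gvh.
have [u' u'0 uu'] := m_muF_recenter u0 fuh.
have [v' v'0 vv'] := m_muF_recenter v0 gvh.
pose w : {mfun T >-> R} := u' \min v'.
have w0 : positive_unit w by move=> x /=; rewrite lt_min u'0 v'0.
exists (m_muF mu I h w); split; [by exists h, w|exact: m_muF_refl|].
move=> k [Ihk [E fE Ehk]]; split; [apply: uu'|apply: vv'];
  split => //; exists E => // x nEx; have := Ehk x nEx;
  by rewrite /= lt_min => /andP[].
Qed.

(* The ring of measurable functions, carrying the m^I_{mu,F}-topology. *)
Definition mIF_space mu (I : ring_ideal {mfun T >-> R}) : Type :=
  {mfun T >-> R}.

HB.instance Definition _ mu I :=
  GRing.ComNzRing.copy (mIF_space mu I) {mfun T >-> R}.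

HB.instance Definition _ mu I :=
  @isBaseTopological.Build (mIF_space mu I) (set {mfun T >-> R})
    (m_muF_base mu I) id (m_muF_base_cover mu I) (@m_muF_base_join mu I).

End definitions.

(* Main.v *)
From HB Require Import structures.
Require Import Defs.
From mathcomp Require Import all_boot all_order all_algebra.
From mathcomp Require Import all_classical all_reals all_analysis.
From mathcomp Require Import measurable_realfun.
From mathcomp Require Import ring.

(* If [h * g] is bounded off a finite-measure set, so is [k * g] for every [k]
   in the basic neighbourhood of [h] given by the unit [1 / (1 + |g|)].  Hence
   both [I] and the sets [{h | h * g \in L^infty_F}] are clopen, and their
   intersection contains the component of [0].  Conversely, for [f] in the
   intersection, [t |-> t * f] is continuous because [f / u] is bounded off a
   finite-measure set for each positive unit [u]; its image is a connected set
   containing [0] and [f]. *)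

Import Order.TTheory GRing.Theory Num.Theory.
Import numFieldNormedType.Exports.

Local Open Scope classical_set_scope.
Local Open Scope ring_scope.

Section component.
Context {R : realType} {d : measure_display} {T : measurableType d}.
Context {mu : {measure set T -> \bar R}} {I : ring_ideal {mfun T >-> R}}.
Implicit Types f g h k u : {mfun T >-> R}.

(** By [m_muF_recenter], a basic set through [h] contains one centred at [h], so centred basic sets
    suffice to test openness. *)
Lemma open_mIF_spaceP (B : set (mIF_space mu I)) :
  open B <-> forall h, B h ->
    exists2 u, positive_unit u & m_muF mu I h u `<=` B.
Proof.
split=> [[D' sD <-] h [C D'C Ch]|BP].
  have [f [u [u0 Cfu]]] := sD _ D'C; move: Ch; rewrite Cfu => Ch.
  have [v v0 sv] := m_muF_recenter u0 Ch.
  exists v => // k /sv fuk; exists C => //; by rewrite Cfu.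
exists [set C | m_muF_base mu I C /\ C `<=` B] => [C []//|].
apply/seteqP; split => [h [C [_ sC] /sC]//|h Bh].
have [u u0 sB] := BP h Bh.
exists (m_muF mu I h u); last exact: m_muF_refl.
by split => //; exists h, u.
Qed.

Lemma connected_component_clopen (X : topologicalType) (x : X) (C : set X) :
  open C -> closed C -> C x -> connected_component [set: X] x `<=` C.
Proof.
move=> oC cC Cx y [A [Ax _ connA] Ay].
suff : A `&` C = A by move=> eqA; move: Ay; rewrite -eqA => -[].
by apply: connA; [exists x|exists C|exists C].
Qed.

(** A locally constant predicate has open truth set and open complement, so its truth set is
    clopen. *)
Lemma connected_component0_sub (P : set {mfun T >-> R}) :
  P 0 ->
  (forall h, exists2 u, positive_unit u &
     forall k, m_muF mu I h u k -> (P h <-> P k)) ->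
  connected_component [set: mIF_space mu I] 0 `<=` P.
Proof.
move=> P0 locP; apply: connected_component_clopen => //.
- apply/open_mIF_spaceP => h Ph; have [u u0 hu] := locP h.
  by exists u => // k /hu [+ _]; exact.
- rewrite -openC; apply/open_mIF_spaceP => h Ph; have [u u0 hu] := locP h.
  by exists u => // k /hu [_ hk] /hk.
Qed.

Lemma positive_unit1 : positive_unit (1 : {mfun T >-> R}).
Proof. by move=> x /=; exact: ltr01. Qed.

Lemma ideal_setN {A : comNzRingType} {J : ring_ideal A} {a} :
  ideal_set J a -> ideal_set J (- a).
Proof. by rewrite -mulN1r; exact: ideal_hasM. Qed.

(** Whatever the unit [u], a basic set lies in a single coset of [I]. *)
Lemma ideal_set_m_muF h u k :
  m_muF mu I h u k -> ideal_set I h <-> ideal_set I k.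
Proof.
move=> [Ihk _]; split=> [Ih|Ik].
  have -> : k = h + - (h - k) by rewrite opprB addrC subrK.
  by apply: ideal_hasD => //; exact: ideal_setN.
have -> : h = (h - k) + k by rewrite subrK.
exact: ideal_hasD.
Qed.

Lemma positive_unitV {u} : positive_unit u ->
  exists2 v, positive_unit v & forall x, v x = (u x)^-1.
Proof.
move=> u0.
have mv : measurable_fun [set: T] (fun x => (u x)^-1).
  (* On nonnegative values the inverse is the power with exponent [-1], which is measurable. *)
  rewrite (_ : (fun x => _) = (fun x => u x `^ (-1))).
    exact: measurableT_comp (measurable_powR _) _.
  by apply/funext => x; rewrite powR_inv1// ltW.
pose v : {mfun T >-> R} := HB.pack (fun x => (u x)^-1)
  (isMeasurableFun.Build _ _ _ _ _ mv).
by exists v => // x; rewrite /= invr_gt0.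
Qed.

(** Off [E], the products differ by at most [|g| / (1 + |g|) <= 1], so a bound [M] for [h * g]
    becomes [M + 1] for [k * g]. *)
Lemma Linfty_F_near h k g (E : set T) : finite_measure_set mu E ->
  (forall x, ~ E x -> `|h x - k x| <= (1 + `|g x|)^-1) ->
  Linfty_F mu (h * g) -> Linfty_F mu (k * g).
Proof.
move=> fE hk [F fF [M hM]]; exists (E `|` F); first exact: finite_measure_setU.
exists (M + 1) => x /not_orP[/hk {}hk /hM {}hM].
rewrite -[X in `|X|]/(k x * g x); rewrite -[X in `|X|]/(h x * g x) in hM.
have -> : k x * g x = h x * g x - (h x - k x) * g x by ring.
rewrite (le_trans (ler_normB _ _))// lerD// normrM.
rewrite (le_trans (ler_wpM2r _ hk))// mulrC ler_pdivrMr; last by rewrite ltr_pwDl.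
by rewrite mul1r lerDr.
Qed.

Lemma Linfty_F_mul_local g h : exists2 u, positive_unit u &
  forall k, m_muF mu I h u k -> (Linfty_F mu (h * g) <-> Linfty_F mu (k * g)).
Proof.
have m1g : measurable_fun [set: T] (fun x => 1 + `|g x|).
  by apply: measurable_funD => //; exact: measurableT_comp.
pose w : {mfun T >-> R} := HB.pack (fun x => 1 + `|g x|)
  (isMeasurableFun.Build _ _ _ _ _ m1g).
have [x|u u0 uE] := @positive_unitV w; first by rewrite ltr_pwDl.
exists u => // k [_ [E fE hk]].
(* The estimate is symmetric in [h] and [k], so one unit serves both directions. *)
split; apply: Linfty_F_near fE _ => x /hk; rewrite uE => /ltW //.
by rewrite distrC.
Qed.

Lemma scale_continuous f : ideal_set I f -> Lpsi_F mu f ->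
  continuous (fun t : R => (cst t : {mfun T >-> R}) * f : mIF_space mu I).
Proof.
move=> If Lf; apply/continuousP => A /open_mIF_spaceP oA.
rewrite openE => t At; have [u u0 sA] := oA _ At.
have [v v0 vE] := positive_unitV u0.
have [E fE [M hM]] := Lf v.
have M0 : 0 < `|M| + 1 by rewrite ltr_pwDr.
(* Off [E], [|f| <= M * u < (|M| + 1) * u], so this radius forces [|t - s| * |f| < u]. The added [1]
   keeps the radius well defined and the inequality strict. *)
apply/nbhs_ballP; exists (`|M| + 1)^-1 => /=; first by rewrite invr_gt0.
move=> s /= ts; apply: sA; split.
  by rewrite -mulrBl; exact: ideal_hasM.
exists E => // x /hM{hM}.
have -> : (f * v) x = f x / u x by rewrite -vE.
move=> hM; have -> : ((cst t : {mfun T >-> R}) * f) x -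
    ((cst s : {mfun T >-> R}) * f) x = (t - s) * f x by rewrite mulrBl.
rewrite normrM; have {}hM : `|f x| <= M * u x.
  by move: hM; rewrite normrM normfV (gtr0_norm (u0 x)) ler_pdivrMr.
have {}hM : `|f x| < (`|M| + 1) * u x.
  by rewrite (le_lt_trans hM)// ltr_pM2r// ltr_pwDr// ler_norm.
move: ts; rewrite -ball_normE /= => ts.
rewrite (le_lt_trans (ler_wpM2r _ (ltW ts)))//.
by rewrite mulrC ltr_pdivrMr// mulrC.
Qed.

Lemma ideal_Lpsi_sub_component :
  ideal_set I `&` Lpsi_F mu `<=`
  connected_component [set: mIF_space mu I] (0 : mIF_space mu I).
Proof.
move=> f [If Lf].
pose phi (t : R) : mIF_space mu I := (cst t : {mfun T >-> R}) * f.
have phi_cont : continuous phi by exact: scale_continuous.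
apply: (@connected_component_max _ _ (phi @` [set: R])) => //.
- by exists 0 => //; apply/mfuneqP => x /=; rewrite mul0r.
- apply: connected_continuous_connected.
    exact/connected_intervalP.
  exact: continuous_subspaceT.
- by exists 1 => //; apply/mfuneqP => x /=; rewrite mul1r.
Qed.

End component.

Theorem theorem6p21 (R : realType) (d : measure_display) (T : measurableType d)
    (mu : {measure set T -> \bar R}) (muT : mu [set: T] = +oo%E)
    (I : ring_ideal {mfun T >-> R}) :
  connected_component [set: mIF_space mu I] (0 : mIF_space mu I) =
  ideal_set I `&` Lpsi_F mu.
Proof.
apply/seteqP; split; last exact: ideal_Lpsi_sub_component.
have I0 : connected_component [set: mIF_space mu I] 0 `<=` ideal_set I.
  apply: connected_component0_sub; first exact: ideal_has0.
  move=> h; exists 1; [exact: positive_unit1|exact: ideal_set_m_muF].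
move=> f comp_f; split; first exact: I0.
(* [Lpsi_F mu] is the intersection over [g] of these clopen sets, so each [g] is treated
   separately. *)
move=> g; apply: (@connected_component0_sub _ _ _ mu I
  [set h | Linfty_F mu (h * g)]) comp_f => /=.
  exists set0; first by split; [exact: measurable0|rewrite measure0 ltry].
  by exists 0 => x _; rewrite mul0r normr0.
by move=> h; exact: Linfty_F_mul_local.
Qed.
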